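(* Let $\mathcal{J}$ be a maximal ideal on $\mathbb{N}$ and define $\delta:\mathcal{P}(\mathbb{N})\to[0,1]$ by $\delta(A)=\lim^{\mathcal{J}}\frac{|A\cap\{1,\dots,n\}|}{n}$. Then $\mathcal{Z}_\delta=\{A\subseteq\mathbb{N}:\delta(A)=0\}$ is not a T-maximal ideal.
   Context: For $A\subseteq\mathbb{N}$ and $k\in\mathbb{Z}$, $A+k$ denotes $\{a+k:a\in A\}\cap\mathbb{N}$. An ideal on $\mathbb{N}$ is a family $\mathcal{I}\subseteq\mathcal{P}(\mathbb{N})$ closed under finite unions and subsets, containing all finite subsets of $\mathbb{N}$, with $\mathbb{N}\notin\mathcal{I}$; it is maximal if it is not properly contained in another ideal on $\mathbb{N}$, and translation invariant if $A+k\in\mathcal{I}$ for all $A\in\mathcal{I}$, $k\in\mathbb{Z}$. A translation invariant ideal $\mathcal{I}$ is T-maximal if for every translation invariant ideal $\mathcal{K}$, $\mathcal{I}\subseteq\mathcal{K}$ implies $\mathcal{I}=\mathcal{K}$. For an ideal $\mathcal{J}$, a real sequence $(x_n)$ is $\mathcal{J}$-convergent to $L$, written $L=\lim^{\mathcal{J}}x_n$, if $\{n\in\mathbb{N}:|x_n-L|\ge\varepsilon\}\in\mathcal{J}$ for every $\varepsilon>0$ (for maximal $\mathcal{J}$ every bounded sequence has a unique such limit). *)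

(* Defs.v *)
From mathcomp Require Export all_boot all_order all_algebra.
From mathcomp Require Export finmap.
From mathcomp Require Export all_classical all_reals.

Set Implicit Arguments.
Unset Strict Implicit.
Unset Printing Implicit Defensive.

Import Order.TTheory GRing.Theory Num.Theory.

Local Open Scope classical_set_scope.
Local Open Scope ring_scope.

(* The natural numbers start at 1, so that |A ∩ {1, ..., n}| / n makes sense
   for every index n. *)
Notation posnat := {n : nat | (0 < n)%N}.

Definition shift (A : set posnat) (k : int) : set posnat :=
  [set b | exists2 a, A a & (val b)%:Z = (val a)%:Z + k].

Record ideal (I : set (set posnat)) : Prop := Ideal {
  ideal_setU : forall A B, I A -> I B -> I (A `|` B);
  ideal_subset : forall A B, A `<=` B -> I B -> I A;
  ideal_finite : forall A, finite_set A -> I A;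
  ideal_proper : ~ I setT }.

Definition maximal_ideal (I : set (set posnat)) : Prop :=
  ideal I /\ forall K, ideal K -> ~ (I `<` K).

Definition translation_invariant (I : set (set posnat)) : Prop :=
  forall A k, I A -> I (shift A k).

Definition T_maximal (I : set (set posnat)) : Prop :=
  [/\ ideal I, translation_invariant I &
      forall K, ideal K -> translation_invariant K -> I `<=` K -> I = K].

Definition ideal_cvg (R : realType) (J : set (set posnat))
    (x : posnat -> R) (L : R) : Prop :=
  forall eps : R, 0 < eps -> J [set n | eps <= `|x n - L|].

(* The default 0 is never reached for a bounded sequence and a maximal ideal,
   see ideal_lim_cvg and ideal_lim_unique. *)
Definition ideal_lim (R : realType) (J : set (set posnat))
    (x : posnat -> R) : R :=
  xget 0 [set L | ideal_cvg J x L].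

Lemma maximal_ideal_setC (J : set (set posnat)) (A : set posnat) :
  maximal_ideal J -> J A \/ J (~` A).
Proof.
move=> [iJ maxJ]; have [JA|nJA] := pselect (J A); first by left.
right; pose K := [set B | exists2 C, J C & B `<=` A `|` C].
have [KT|nKT] := pselect (K setT).
  have [C JC sC] := KT; apply: (ideal_subset iJ) JC => n nAn.
  by have [|//] := sC n I => /nAn.
exfalso; apply: (maxJ K); first split=> //.
- move=> B B' [C JC sB] [C' JC' sB']; exists (C `|` C').
    exact: ideal_setU.
  by move=> n [/sB|/sB'] []; [left|right; left|left|right; right].
- by move=> B B' sB [C JC sB']; exists C => //; apply: subset_trans sB'.
- by move=> B fB; exists B; [exact: ideal_finite|exact: subsetUr].
split=> [B JB|]; first by exists B => //; exact: subsetUr.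
move=> sKJ; apply/nJA/sKJ; exists set0; last exact: subsetUl.
exact/(ideal_finite iJ)/finite_set0.
Qed.

Lemma ideal_lim_cvg (R : realType) (J : set (set posnat)) (x : posnat -> R)
    (M : R) :
  maximal_ideal J -> (forall n, `|x n| <= M) -> ideal_cvg J x (ideal_lim J x).
Proof.
move=> mJ xM; have iJ := mJ.1.
suff [L xL] : exists L, ideal_cvg J x L by exact: (xgetPex 0 (ex_intro _ L xL)).
pose S := [set r | J [set n | x n < r]].
have J0 : J set0 by apply/(ideal_finite iJ)/finite_set0.
have supS : has_sup S.
  split.
    exists (- M); apply: (ideal_subset iJ) J0 => n /=.
    by move=> xnM; have := xM n; rewrite ler_norml leNgt xnM.
  exists M => r Jr; rewrite leNgt; apply/negP => Mr.
  apply: (ideal_proper iJ); apply: (ideal_subset iJ) Jr => n _ /=.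
  by apply: le_lt_trans Mr; apply: le_trans (xM n); exact: ler_norm.
exists (sup S) => eps e0.
have e20 : 0 < eps / 2 by rewrite divr_gt0.
have e2e : eps / 2 < eps by rewrite ltr_pdivrMr// ltr_pMr// ltr1n.
have [r Sr ltr] := sup_adherent e20 supS.
have JG : J [set n | sup S + eps / 2 <= x n].
  have [JL|] := maximal_ideal_setC [set n | x n < sup S + eps / 2] mJ.
    have := sup_upper_bound supS JL.
    by rewrite leNgt ltrDl e20.
  by apply: (ideal_subset iJ) => n /= h; apply/negP; rewrite -leNgt.
apply: (ideal_subset iJ) (ideal_setU iJ Sr JG) => n /=.
rewrite ler_normr => /orP[h|h]; [right|left].
  by rewrite addrC -lerBrDr; apply: le_trans h; exact: ltW.
apply: le_lt_trans ltr; rewrite lerBrDr -lerBrDl; apply: ltW.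
by apply: lt_le_trans e2e _; rewrite opprB in h.
Qed.

Lemma ideal_lim_unique (R : realType) (J : set (set posnat)) (x : posnat -> R)
    (L : R) :
  ideal J -> ideal_cvg J x L -> ideal_lim J x = L.
Proof.
move=> iJ xL; apply: xget_unique => // L' xL'; apply/eqP/negPn/negP => neq.
have d0 : 0 < `|L' - L| / 2 by rewrite divr_gt0// normr_gt0 subr_eq0.
apply: (ideal_proper iJ).
apply: (ideal_subset iJ) (ideal_setU iJ (xL _ d0) (xL' _ d0)) => n _ /=.
have [h|h] := leP (`|L' - L| / 2) `|x n - L|; first by left.
right; rewrite leNgt; apply/negP => h'.
have := ltrD h h'; rewrite -splitr ltNge => /negP; apply.
by rewrite [X in _ <= _ + X]distrC [leRHS]addrC; exact: ler_distD.
Qed.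

Definition initial_freq (R : realType) (A : set posnat) (n : posnat) : R :=
  (#|` fset_set (A `&` [set i | (val i <= val n)%N])|)%:R / (val n)%:R.

Definition ideal_density (R : realType) (J : set (set posnat))
    (A : set posnat) : R :=
  ideal_lim J (@initial_freq R A).

Definition zero_density (R : realType) (J : set (set posnat)) :
    set (set posnat) :=
  [set A | ideal_density R J A = 0].

(* Main.v *)
Require Import Defs.
From mathcomp Require Import zify.

Set Implicit Arguments.
Unset Strict Implicit.
Unset Printing Implicit Defensive.

Import Order.TTheory GRing.Theory Num.Theory.

Local Open Scope classical_set_scope.
Local Open Scope ring_scope.

(** An ideal strictly above the null ideal is generated by the null sets and the
    translates of a set [A] of positive density.  It is proper as soon as no
    finite union of translates of [A] has full measure, and this holds when the
    gaps of [A] of length at least [m] occur with positive frequency for every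
    [m].  We take for [A] the complement of the union over [m >= 1] of the blocks
    [[j 8^m, j 8^m + 2^m[] with [j >= 1]: these blocks cover at most one third of
    every initial segment because [\sum_m 2^m / 8^m = 1/3]. *)

(** The index [m] stands for the block length 2^(m+1). The first conjunct excludes j = 0, for which
    every integer would lie in some block. *)
Definition in_block (i m : nat) : bool :=
  ((8 ^ m.+1 <= i) && (i %% 8 ^ m.+1 < 2 ^ m.+1))%N.

(** Searching below [i] loses nothing, since a block of index m only contains integers i >= 8^(m+1)
    > m. *)
Definition in_gap (i : nat) : bool := has (in_block i) (iota 0 i).

Lemma in_gap_block (i m : nat) : in_block i m -> in_gap i.
Proof.
move=> im; apply/hasP; exists m => //; rewrite mem_iota /= add0n.
have /andP[+ _] := im; apply: leq_trans.
by rewrite (leq_trans (ltnSn m))// ltnW// ltn_expl.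
Qed.

(** The second summand makes the induction close: with q = n %/ 8^N and t = 2^N, the step reads 3 *
    2t(q %/ 8) + 2t(q %/ 8) = 8t(q %/ 8) <= tq. *)
Lemma sum_block_sizes_le (n N : nat) :
  (3 * (\sum_(m < N) 2 ^ m.+1 * (n %/ 8 ^ m.+1)) + 2 ^ N * (n %/ 8 ^ N) <= n)%N.
Proof.
elim: N => [|N IH]; first by rewrite big_ord0 expn0 divn1 muln0 add0n mul1n.
apply: leq_trans IH; rewrite big_ord_recr /= mulnDr -addnA leq_add2l.
rewrite !expnS [(8 * _)%N]mulnC divnMA.
set q := (n %/ _)%N; set t := (2 ^ N)%N.
have : (q %/ 8 * 8 <= q)%N by rewrite leq_divM.
nia.
Qed.

Lemma count_in_gap_le (n : nat) : (3 * count in_gap (iota 1 n) <= n)%N.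
Proof.
(* Union bound: the blocks may overlap or run past [n], but their concatenation contains every gap
   point up to [n]. *)
pose blocks m := [seq (j * 8 ^ m.+1 + r)%N
  | j <- iota 1 (n %/ 8 ^ m.+1), r <- iota 0 (2 ^ m.+1)].
have size_blocks : size (flatten [seq blocks m | m <- iota 0 n]) =
    (\sum_(m < n) 2 ^ m.+1 * (n %/ 8 ^ m.+1))%N.
  rewrite size_flatten /shape -map_comp sumnE big_map -(big_mkord xpredT
    (fun m => 2 ^ m.+1 * (n %/ 8 ^ m.+1))%N) /index_iota subn0.
  by apply: eq_bigr => m _ /=; rewrite size_allpairs !size_iota mulnC.
have le_count : (count in_gap (iota 1 n) <=
    size (flatten [seq blocks m | m <- iota 0 n]))%N.
  rewrite -size_filter; apply: uniq_leq_size; first by rewrite filter_uniq ?iota_uniq.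
  move=> i; rewrite mem_filter mem_iota => /andP[/hasP[m + /andP[le_mi lt_rm]]].
  rewrite mem_iota => /andP[_ lt_mi] /andP[_ lt_in].
  apply/flatten_mapP; exists m; first by rewrite mem_iota /=; lia.
  apply/allpairsP; exists (i %/ 8 ^ m.+1, i %% 8 ^ m.+1)%N; split=> /=.
  - rewrite mem_iota divn_gt0 ?expn_gt0// le_mi /= add1n ltnS.
    by apply: leq_div2r; lia.
  - by rewrite mem_iota.
  - exact: divn_eq.
apply: leq_trans (leq_trans (leq_addr _ _) (sum_block_sizes_le n n)).
by rewrite -size_blocks leq_pmul2l.
Qed.

(** Since 2m < 2^(m+1), the block at j 8^(m+1) contains the whole m-neighbourhood of j 8^(m+1) +
    m. *)
Lemma in_gap_near (m j i : nat) :
  (0 < j)%N -> (j * 8 ^ m.+1 <= i)%N -> (i <= j * 8 ^ m.+1 + m + m)%N -> in_gap i.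
Proof.
move=> j0 le_ji le_ij; apply: (@in_gap_block i m); rewrite /in_block.
have lt_m : (m < 2 ^ m)%N by exact: ltn_expl.
have lt_28 : (2 ^ m.+1 <= 8 ^ m.+1)%N by rewrite leq_exp2r.
have -> : i = (j * 8 ^ m.+1 + (i - j * 8 ^ m.+1))%N by rewrite subnKC.
rewrite expnS in lt_28.
rewrite modnMDl modn_small ?expnS; last by move: le_ij lt_28; rewrite expnS; nia.
by apply/andP; split; [rewrite expnS in le_ji; nia|move: le_ij; rewrite expnS; lia].
Qed.

Lemma finite_initial (A : set posnat) (n : nat) :
  finite_set (A `&` [set i | (val i <= n)%N]).
Proof.
apply: (@sub_finite_set _ _ ((val : posnat -> nat) @^-1` `I_n.+1)).
  by move=> i [].
by apply: finite_preimage (finite_II _) => i j _ _; exact: val_inj.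
Qed.

Lemma initial_freq_ge0 (R : realType) (A : set posnat) (n : posnat) :
  0 <= initial_freq R A n.
Proof. by rewrite divr_ge0. Qed.

Lemma initial_freq_le1 (R : realType) (A : set posnat) (n : posnat) :
  initial_freq R A n <= 1.
Proof.
rewrite /initial_freq ler_pdivrMr ?mul1r ?ltr0n ?(valP n)// ler_nat.
set S := fset_set _; rewrite -(size_map val) -[leqRHS](size_iota 1).
apply: uniq_leq_size; first by rewrite map_inj_uniq ?fset_uniq//; exact: val_inj.
move=> i /mapP[x xS ->]; rewrite mem_iota add1n ltnS (valP x) /=.
by move: xS; rewrite in_fset_set ?inE; [case|exact: finite_initial].
Qed.

Lemma initial_freq_ge (R : realType) (A : set posnat) (n : posnat) (s : seq nat)
    (c : nat) :
  uniq s ->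
  (forall i, i \in s -> exists x : posnat, [/\ val x = i, (i <= val n)%N & A x]) ->
  (0 < c)%N -> (val n <= c * size s)%N -> c%:R^-1 <= initial_freq R A n.
Proof.
move=> us sA c0 le_nc.
rewrite /initial_freq ler_pdivlMr ?ltr0n ?(valP n)// ler_pdivrMl ?ltr0n//.
rewrite -natrM ler_nat; apply: leq_trans le_nc _; rewrite leq_pmul2l//.
rewrite -(size_map val); apply: uniq_leq_size => // i /sA[x [<- xn Ax]].
by apply/map_f; rewrite in_fset_set ?inE//; exact: finite_initial.
Qed.

(** Frequencies are bounded by 1, so the value 0 is a true limit and not the default of
    [ideal_lim]. *)
Lemma zero_density_cvg (R : realType) (J : set (set posnat)) (A : set posnat) :
  maximal_ideal J -> zero_density R J A -> ideal_cvg J (@initial_freq R A) 0.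
Proof.
move=> mJ <-; apply: (@ideal_lim_cvg R J _ 1) => // n.
by rewrite ger0_norm ?initial_freq_ge0 ?initial_freq_le1.
Qed.

Lemma initial_freq_ge_not_null (R : realType) (J : set (set posnat))
    (A : set posnat) (c : R) (N : nat) :
  maximal_ideal J -> 0 < c ->
  (forall n : posnat, (N < val n)%N -> c <= initial_freq R A n) ->
  ~ zero_density R J A.
Proof.
move=> mJ c0 cA /(zero_density_cvg mJ)/(_ c c0) JA; have iJ := mJ.1.
apply: (ideal_proper iJ).
have JN := ideal_finite iJ (finite_initial setT N).
apply: (ideal_subset iJ) (ideal_setU iJ JA JN) => n _ /=.
have [nN|Nn] := leqP (val n) N; first by right.
by left; rewrite subr0 ger0_norm ?initial_freq_ge0 ?cA.
Qed.

(** This is the union of the translates A + k with |k| <= m; every finite union of translates lies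
    in one of these. *)
Definition thickening (A : set posnat) (m : nat) : set posnat :=
  [set b | exists a, [/\ A a, (val a <= val b + m)%N & (val b <= val a + m)%N]].

Lemma subset_thickening (A : set posnat) (m p : nat) :
  (m <= p)%N -> thickening A m `<=` thickening A p.
Proof. by move=> mp b [a [Aa ab ba]]; exists a; split=> //; lia. Qed.

Lemma shift_thickening (A : set posnat) (m : nat) (k : int) :
  shift (thickening A m) k `<=` thickening A (m + `|k|%N).
Proof. by move=> c [b [a [Aa ab ba]] cbk]; exists a; split=> //; lia. Qed.

Definition thickening_ideal (I : set (set posnat)) (A : set posnat) :
    set (set posnat) :=
  [set X | exists Z m, I Z /\ X `<=` Z `|` thickening A m].

Lemma ideal_thickening (I : set (set posnat)) (A : set posnat) :
  ideal I -> (forall m, ~ I (~` thickening A m)) -> ideal (thickening_ideal I A).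
Proof.
move=> iI nIA; split.
- move=> X Y [Z [m [IZ sX]]] [W [p [IW sY]]].
  exists (Z `|` W), (maxn m p); split; first exact: ideal_setU.
  move=> n [/sX[]|/sY[]] h; [by left; left|right|by left; right|right].
    by apply: subset_thickening h; exact: leq_maxl.
  by apply: subset_thickening h; exact: leq_maxr.
- by move=> X Y sXY [Z [m [IZ sY]]]; exists Z, m; split=> // n /sXY/sY.
- move=> X fX; exists X, 0%N; split; first exact: ideal_finite.
  exact: subsetUl.
(* If [Z] and the thickening cover everything, the complement of the thickening lies in [Z]. *)
- move=> [Z [m [IZ sT]]]; apply: (nIA m); apply: (ideal_subset iI) IZ.
  by move=> n nA; have [] := sT n Logic.I.
Qed.

Lemma translation_invariant_thickening (I : set (set posnat)) (A : set posnat) :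
  translation_invariant I -> translation_invariant (thickening_ideal I A).
Proof.
move=> tI X k [Z [m [IZ sX]]]; exists (shift Z k), (m + `|k|%N)%N.
split; first exact: tI.
move=> c [b /sX[Zb|Ab] cbk]; first by left; exists b.
by right; apply: shift_thickening; exists b.
Qed.

Lemma T_maximal_thickening (I : set (set posnat)) (A : set posnat) :
  T_maximal I -> (forall m, ~ I (~` thickening A m)) -> I A.
Proof.
move=> [iI tI maxI] nIA.
have {maxI} IK : I = thickening_ideal I A.
  apply: maxI; first exact: ideal_thickening.
    exact: translation_invariant_thickening.
  by move=> Z IZ; exists Z, 0%N; split=> //; exact: subsetUl.
rewrite IK; exists set0, 0%N; split.
  exact/(ideal_finite iI)/finite_set0.
by move=> a Aa; right; exists a; rewrite addn0.
Qed.

Definition non_gaps : set posnat := [set i | ~~ in_gap (val i)].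

Lemma initial_freq_non_gaps_ge (R : realType) (n : posnat) :
  2%:R^-1 <= initial_freq R non_gaps n.
Proof.
apply: (@initial_freq_ge R _ _ [seq i <- iota 1 (val n) | ~~ in_gap i]) => //.
- by rewrite filter_uniq ?iota_uniq.
- move=> i; rewrite mem_filter mem_iota add1n ltnS => /andP[gi /andP[i0 le_in]].
  by exists (exist _ i i0).
- rewrite size_filter.
  have := count_predC in_gap (iota 1 (val n)); rewrite size_iota.
  have := count_in_gap_le (val n).
  rewrite (_ : count (predC in_gap) _ = count (fun i => ~~ in_gap i) (iota 1 (val n))) //.
  lia.
Qed.

Lemma initial_freq_unthickened_ge (R : realType) (m : nat) (n : posnat) :
  (2 * 8 ^ m.+1 < val n)%N ->
  (3 * 8 ^ m.+1)%:R^-1 <= initial_freq R (~` thickening non_gaps m) n.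
Proof.
set P := (8 ^ m.+1)%N => lt_n.
have P0 : (0 < P)%N by rewrite expn_gt0.
have lt_mP : (m < P)%N by rewrite (leq_trans (ltnSn m))// ltnW// ltn_expl.
have n_eq := divn_eq (val n) P; have n_mod := ltn_pmod (val n) P0.
apply: (@initial_freq_ge R _ _
  (* These points are more than [m] away from [non_gaps]; stopping at j = n %/ P - 1 keeps them
     below [n]. *)
  [seq (j * P + m)%N | j <- iota 1 (val n %/ P).-1]).
- rewrite map_inj_uniq ?iota_uniq// => j j' /addIn/eqP.
  by rewrite eqn_pmul2r// => /eqP.
- move=> i /mapP[j]; rewrite mem_iota => /andP[j0 lt_j] ->.
  have i0 : (0 < j * P + m)%N by rewrite addn_gt0 muln_gt0 j0 P0.
  exists (exist _ (j * P + m)%N i0); split=> //.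
    by move: n_eq n_mod; set q := (val n %/ P)%N in lt_j *; nia.
  case=> a [] /= /negP ngap_a ab ba; apply: ngap_a.
  apply: (@in_gap_near m j) => //.
  by rewrite -/P -(leq_add2r m).
- by rewrite muln_gt0.
- rewrite size_map size_iota.
  (* The factor 3 comes from n < (q + 1)P <= 3P(q - 1), valid for q = n %/ P >= 2. *)
  have q2 : (2 <= val n %/ P)%N by rewrite leq_divRL// ltnW.
  rewrite {1}n_eq; move: n_mod; case: (val n %/ P)%N q2 => [|[|q]] //= _.
  by rewrite mulSn mulSn mulnS [(3 * P * q)%N]mulnAC -mulnA; nia.
Qed.

Theorem theorem3p14 (R : realType) (J : set (set posnat))
    (hJ : maximal_ideal J) :
  ~ T_maximal (zero_density R J).
Proof.
(* T-maximality would force [non_gaps] to be null, against its frequencies of at least 1/2. *)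
move=> /(@T_maximal_thickening _ non_gaps) null_non_gaps.
apply: (@initial_freq_ge_not_null R J non_gaps 2%:R^-1 0) => //.
- by rewrite invr_gt0 ltr0n.
- by move=> n _; exact: initial_freq_non_gaps_ge.
apply: null_non_gaps => m.
apply: (initial_freq_ge_not_null hJ _ (@initial_freq_unthickened_ge R m)).
by rewrite invr_gt0 ltr0n muln_gt0 expn_gt0.
Qed.
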